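(* Let $q>2$ be an integer. (a) (Lower bound.) For every integer $t>0$ and every $(S_1,\dots,S_{2t})\in\mathcal S_{t}^{(q)}$, $$\max_{I\in\mathcal I^{(q)}_{t,1}} D(S_1,\dots,S_{2t};I;t)\ \ge\ \frac{3t-2}{2}.$$ (b) (Upper bound.) If $q=2k$ is even, then for every integer $z\ge 2$ and $t=5\cdot 2^{z-1}-1$ there exists $(S_1,\dots,S_{2t})\in\mathcal S^{(q)}_{t}$ with $$\max_{I\in\mathcal I^{(q)}_{t,1}} D(S_1,\dots,S_{2t};I;t)\ \le\ \frac{8t-2}{5}.$$
   Context: For a positive integer $n$ let $[n]=\{1,\dots,n\}$, and for a finite set $S$ of integers let $\Sigma(S)=\sum_{x\in S}x$. For positive integers $t,q$, $\mathcal S^{(q)}_t$ is the set of all ordered tuples $(S_1,\dots,S_{2t})$ of pairwise disjoint $q$-element sets with $\bigcup_i S_i=[2tq]$ such that $\Sigma(S_{2i-1})=\Sigma(S_{2i})$ for all $i\in[t]$. $\mathcal I^{(q)}_{t,1}$ is the family of all (possibly empty) sets of swaps $I=\{(i_1,i_1+1),\dots,(i_m,i_m+1)\}$ with $i_\ell,i_\ell+1\in[2tq]$, such that no element of $[2tq]$ occurs in two different swaps of $I$. Applying $I$ to $(S_1,\dots,S_{2t})$ means exchanging the labels $i_\ell$ and $i_\ell+1$ for every $\ell$; the resulting sets are denoted $S'_1,\dots,S'_{2t}$. The total discrepancy is $D(S_1,\dots,S_{2t};I;t)=\sum_{i=1}^t|\Sigma(S'_{2i-1})-\Sigma(S'_{2i})|$.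 *)

(* Defs.v *)
From mathcomp Require Import all_boot all_order all_algebra all_fingroup.
Set Implicit Arguments. Unset Strict Implicit. Unset Printing Implicit Defensive.
Import Order.TTheory GRing.Theory Num.Theory.

(* The ground set [n] = {1, ..., n} is encoded by 'I_n: the ordinal x stands   *)
(* for the integer x.+1. Tuples are 0-indexed: the i-th pair (S_(2i-1), S_2i), *)
(* 1 <= i <= t, sits at positions 2j and 2j+1 with j = i - 1.                  *)

Definition Sigma (n : nat) (A : {set 'I_n}) : nat := \sum_(x in A) x.+1.

Definition balanced_family (q t : nat)
    (S : (2 * t).-tuple {set 'I_(2 * t * q)}) : Prop :=
  [/\ forall i : 'I_(2 * t), #|tnth S i| = q,
      forall i j : 'I_(2 * t), i != j -> [disjoint tnth S i & tnth S j],
      \bigcup_(i < 2 * t) tnth S i = [set: 'I_(2 * t * q)]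
    & forall j : 'I_t, Sigma (nth set0 S (2 * j)) = Sigma (nth set0 S (2 * j + 1))].

Definition swap_family (n : nat) : {set {set 'I_n * 'I_n}} :=
  [set I : {set 'I_n * 'I_n} |
    [forall s in I, val s.2 == (val s.1).+1] &&
    [forall s in I, forall r in I,
       (s != r) ==> [disjoint [set s.1; s.2] & [set r.1; r.2]]]].

(* For I in swap_family n, at most one swap of I involves x, so the choice     *)
(* made by [pick] is immaterial.                                               *)
Definition swap_label (n : nat) (I : {set 'I_n * 'I_n}) (x : 'I_n) : 'I_n :=
  if [pick s in I | x \in [set s.1; s.2]] is Some s then tperm s.1 s.2 x else x.

Definition apply_swaps (n : nat) (I : {set 'I_n * 'I_n}) (A : {set 'I_n}) :
    {set 'I_n} :=
  swap_label I @: A.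

Definition discrepancy (q t : nat) (S : (2 * t).-tuple {set 'I_(2 * t * q)})
    (I : {set 'I_(2 * t * q) * 'I_(2 * t * q)}) : nat :=
  \sum_(j < t) `|Posz (Sigma (apply_swaps I (nth set0 S (2 * j))))
               - Posz (Sigma (apply_swaps I (nth set0 S (2 * j + 1))))|%N.

(* The empty set of swaps belongs to swap_family, so the default value 0 of    *)
(* \max plays no role.                                                         *)
Definition max_discrepancy (q t : nat)
    (S : (2 * t).-tuple {set 'I_(2 * t * q)}) : nat :=
  \max_(I in swap_family (2 * t * q)) discrepancy S I.

(* Main.v *)
Require Import Defs.
From mathcomp Require Import all_boot all_order all_algebra all_fingroup.
From mathcomp Require Import zify ring lra.
Set Implicit Arguments. Unset Strict Implicit. Unset Printing Implicit Defensive.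
Import Order.TTheory GRing.Theory Num.Theory.
Local Open Scope ring_scope.

(** Read a family as the word whose x-th letter is the index of the set
    containing x. A choice of signs eps_1, ..., eps_t for the t differences
    Sigma(S'_(2i-1)) - Sigma(S'_2i) turns the word into a word of signs, and a
    swap changes the signed sum of the differences by the sign of its left
    letter minus the sign of its right one. Since the falls (a + followed by a
    -) of a sign word never overlap, the largest discrepancy is twice the
    largest number of falls over all eps.

    Lower bound: for random eps two adjacent distinct letters form a fall with
    probability at least 1/4. Each pair of sets occupies at least three runs of
    letters, as two runs would make one of the sums smaller; so there are at
    least 3t - 1 pairs of adjacent distinct letters.

    Upper bound: for q = 2 take the word a b c B B C b A A d C D D c d a, with
    t = 4 and at most 3 falls, and replace repeatedly w by X w Y Y w' X, where
    w' is a copy of w on fresh letters and X, Y are a new pair. Because w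
    begins and ends with the same letter, exactly one fall is added to those of
    w and w'. Repeating every letter k times handles q = 2k. *)

(** * The effect of swaps on sums of labels *)

Lemma swap_familyP n (I : {set 'I_n * 'I_n}) :
  reflect ((forall s, s \in I -> s.2 = s.1.+1 :> nat) /\
           (forall s r x, s \in I -> r \in I ->
              x \in [set s.1; s.2] -> x \in [set r.1; r.2] -> s = r))
          (I \in swap_family n).
Proof.
rewrite inE; apply: (iffP andP) => -[h1 h2]; split.
- by move=> s sI; apply/eqP; move/forall_inP: h1; apply.
- move=> s r x sI rI xs xr; apply/eqP/negPn/negP => sr.
  move/forall_inP/(_ _ sI)/forall_inP/(_ _ rI): h2; rewrite sr /=.
  by move/disjoint_setI0/setP/(_ x); rewrite in_setI xs xr inE.
- by apply/forall_inP => s sI; apply/eqP/h1.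
apply/forall_inP => s sI; apply/forall_inP => r rI; apply/implyP => sr.
apply/pred0P => x /=; apply/negP => /andP[xs xr].
by move/eqP: sr; apply; apply: (h2 s r x).
Qed.

Lemma swap_labelK n (I : {set 'I_n * 'I_n}) :
  I \in swap_family n -> involutive (swap_label I).
Proof.
case/swap_familyP=> _ h2 x; rewrite {2}/swap_label.
case: pickP => [s /andP[sI xs]|nox]; last first.
  rewrite /swap_label; case: pickP => // r rx.
  by rewrite nox in rx.
have yin : tperm s.1 s.2 x \in [set s.1; s.2].
  by move: xs; rewrite !in_set2 => /orP[]/eqP->; rewrite ?tpermL ?tpermR eqxx ?orbT.
rewrite /swap_label; case: pickP => [r /andP[rI yr]|/(_ s)]; last by rewrite /= sI yin.
by rewrite (h2 _ _ _ rI sI yr yin) tpermK.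
Qed.

(** At most one swap of [I] moves [x], so at most one term is nonzero; the sum over all of [I] can
    later be exchanged with the sum over a set of labels. *)
Lemma swap_label_shift n (I : {set 'I_n * 'I_n}) (x : 'I_n) :
  I \in swap_family n ->
  ((swap_label I x).+1%:Z = x.+1%:Z + \sum_(s in I) ((x == s.1)%:Z - (x == s.2)%:Z))%R.
Proof.
case/swap_familyP=> h1 h2; rewrite /swap_label.
case: pickP => [s /andP[sI xs]|nox]; last first.
  rewrite big1 ?addr0 // => s sI; have := nox s; rewrite /= sI /= in_set2.
  by case: eqP; case: eqP.
rewrite (bigD1 s) //= big1 ?addr0; last first.
  move=> r /andP[rI rs]; have xr : x \notin [set r.1; r.2].
    by apply/negP => xr; case/eqP: rs; apply: (h2 _ _ x).
  by move: xr; rewrite in_set2; case: eqP; case: eqP.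
have s12 := h1 _ sI; have ne : s.1 != s.2 by rewrite -val_eqE /= s12 neq_ltn ltnSn.
move: xs; rewrite in_set2 => /orP[]/eqP->.
  by rewrite tpermL eqxx (negbTE ne) s12; lia.
by rewrite tpermR eqxx eq_sym (negbTE ne) s12.
Qed.

Lemma Sigma_apply_swaps n (I : {set 'I_n * 'I_n}) (A : {set 'I_n}) :
  I \in swap_family n ->
  (Sigma (apply_swaps I A))%:Z =
  (Sigma A)%:Z + \sum_(s in I) ((s.1 \in A)%:Z - (s.2 \in A)%:Z).
Proof.
move=> hI; rewrite /Sigma /apply_swaps big_imset /=; last first.
  by move=> x y _ _; apply: (inv_inj (swap_labelK hI)).
rewrite !(big_morph Posz PoszD (erefl _)).
under eq_bigr => x _ do rewrite swap_label_shift //.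
rewrite big_split /=; congr (_ + _); rewrite exchange_big /=.
have char (y : 'I_n) : \sum_(x in A) (x == y)%:Z = (y \in A)%:Z.
  case yA: (y \in A); last first.
    by rewrite big1 // => x xA; case: eqP => // xy; rewrite -xy xA in yA.
  rewrite (bigD1 y) //= eqxx big1 // => x /andP[_ /negbTE->] //.
by apply: eq_bigr => s _; rewrite sumrB !char.
Qed.

(** * Swaps and falls of a sign word *)

(* The boolean [true] encodes the sign -1, as in [(-1) ^+ b]. *)
Definition falls (n : nat) (g : nat -> bool) : nat :=
  \sum_(x < n.-1) (~~ g x && g x.+1).

Definition adjacent m (x : 'I_m) : 'I_m.+1 * 'I_m.+1 :=
  (widen_ord (leqnSn m) x, lift ord0 x).

Lemma adjacent_inj m : injective (@adjacent m).
Proof. by move=> x y [/val_inj]. Qed.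

Lemma adjacent_onto m (s : 'I_m.+1 * 'I_m.+1) :
  s.2 = s.1.+1 :> nat -> exists x : 'I_m, s = adjacent x.
Proof.
case: s => a b /= ab; have am : (a < m)%N by have := ltn_ord b; rewrite ab ltnS.
by exists (Ordinal am); congr (_, _); apply: val_inj; rewrite //= ab.
Qed.

(** A swap gains 2 at a fall and otherwise 0 or -2, and each adjacent pair of positions is swapped
    at most once. *)
Lemma swap_gain_le n (I : {set 'I_n * 'I_n}) (g : nat -> bool) :
  I \in swap_family n ->
  \sum_(s in I) ((-1) ^+ g s.1 - (-1) ^+ g s.2) <= (2 * falls n g)%N%:Z.
Proof.
case: n I => [|m] I /swap_familyP[h1 _].
  rewrite big1; last by case=> [[]].
  by [].
have -> : I = @adjacent m @: [set x | adjacent x \in I].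
  apply/setP => s; apply/idP/imsetP => [sI|[x]]; last by rewrite inE => ? ->.
  by have [x sE] := adjacent_onto (h1 _ sI); exists x; rewrite // inE -sE.
rewrite big_imset /=; last by move=> x y _ _; apply: adjacent_inj.
rewrite /falls PoszM (big_morph Posz PoszD (erefl _)) mulr_sumr big_mkcond /=.
by apply: ler_sum => x _; rewrite /bump /=; case: ifP; case: (g x); case: (g _).
Qed.

(** Swapping at all falls is legal: a position shared by two different falls would carry both
    signs. *)
Lemma swap_gain_attained n (g : nat -> bool) :
  exists2 I : {set 'I_n * 'I_n}, I \in swap_family n &
  \sum_(s in I) ((-1) ^+ g s.1 - (-1) ^+ g s.2) = (2 * falls n g)%N%:Z.
Proof.
case: n => [|m].
  exists set0; last by rewrite big_set0 /falls big_ord0.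
  by apply/swap_familyP; split=> [s|s r x]; rewrite inE.
exists (@adjacent m @: [set x : 'I_m | ~~ g x && g x.+1]).
  apply/swap_familyP; split=> [s /imsetP[x _ ->] //|s r x].
  case/imsetP=> y; rewrite inE => /andP[y1 y2] -> /imsetP[z].
  rewrite inE => /andP[z1 z2] ->; rewrite !in_set2 -!val_eqE /= /bump /= !add1n.
  move=> xy xz; congr adjacent; apply: val_inj => /=.
  case/orP: xy => /eqP xy; case/orP: xz => /eqP xz; first lia.
  - by move: y1; rewrite -xy xz z2.
  - by move: z1; rewrite -xz xy y2.
  by move: xz; rewrite xy => -[].
rewrite big_imset /=; last by move=> x y _ _; apply: adjacent_inj.
rewrite /falls PoszM (big_morph Posz PoszD (erefl _)) mulr_sumr big_mkcond /=.
by apply: eq_bigr => x _; rewrite inE /bump /= add1n; case: (g x); case: (g _).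
Qed.

(** * Discrepancy of a coloured word *)

(* The letters 2j and 2j+1 stand for the two sets of the j-th pair; [eps j] is the
   sign given to the difference of their sums. *)
Definition letter_sign (eps : nat -> bool) (l : nat) : bool := eps l./2 (+) odd l.

Section Coloured.
Variables (q t : nat) (S : (2 * t).-tuple {set 'I_(2 * t * q)}) (f : nat -> nat).
Hypothesis f_lt : forall x : 'I_(2 * t * q), (f x < 2 * t)%N.
Hypothesis S_f : forall i, (i < 2 * t)%N ->
  nth set0 S i = [set x : 'I_(2 * t * q) | f x == i].
Hypothesis S_Sigma : forall j : 'I_t,
  Sigma (nth set0 S (2 * j)) = Sigma (nth set0 S (2 * j + 1)).

Lemma letter_sign_sum (eps : nat -> bool) (x : 'I_(2 * t * q)) :
  \sum_(j < t) (-1) ^+ eps j * ((f x == 2 * j)%N%:Z - (f x == 2 * j + 1)%N%:Z)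
  = (-1) ^+ letter_sign eps (f x).
Proof.
have fE := odd_double_half (f x); have fx := f_lt x.
rewrite /letter_sign; move: fE; set h := (f x)./2 => fE.
have jt : (h < t)%N by lia.
rewrite (bigD1 (Ordinal jt)) //= big1 ?addr0; last first.
  move=> j; rewrite -val_eqE /= => /eqP jh.
  have /eqP/negbTE-> : (f x <> 2 * j)%N by move: fE; case: (odd _); lia.
  have /eqP/negbTE-> : (f x <> 2 * j + 1)%N by move: fE; case: (odd _); lia.
  by rewrite subrr mulr0.
rewrite signr_addb; congr (_ * _); rewrite -fE.
case: (odd _).
  have /negbTE-> : (true + h.*2 != 2 * h)%N by apply/eqP=> /=; lia.
  have E : (true + h.*2 = 2 * h + 1)%N by rewrite add1n; lia.
  by rewrite E eqxx oddD mul2n odd_double.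
have -> : (false + h.*2 = 2 * h)%N by rewrite /=; lia.
have /negbTE-> : (2 * h != 2 * h + 1)%N by apply/eqP; lia.
by rewrite eqxx mul2n odd_double.
Qed.

Let gap (I : {set 'I_(2 * t * q) * 'I_(2 * t * q)}) (j : nat) : int :=
  Posz (Sigma (apply_swaps I (nth set0 S (2 * j))))
  - Posz (Sigma (apply_swaps I (nth set0 S (2 * j + 1)))).

(** The two sums of a pair agree before the swaps, so only the changes remain; they are then
    collected swap by swap instead of pair by pair. *)
Lemma signed_gap_sum I (eps : nat -> bool) : I \in swap_family (2 * t * q) ->
  \sum_(j < t) (-1) ^+ eps j * gap I j =
  \sum_(s in I) ((-1) ^+ letter_sign eps (f s.1) - (-1) ^+ letter_sign eps (f s.2)).
Proof.
move=> hI.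
have gapE (j : 'I_t) : gap I j = \sum_(s in I)
   (((f s.1 == 2 * j)%N%:Z - (f s.1 == 2 * j + 1)%N%:Z) -
    ((f s.2 == 2 * j)%N%:Z - (f s.2 == 2 * j + 1)%N%:Z)).
  have jt := ltn_ord j.
  rewrite /gap !Sigma_apply_swaps // S_Sigma opprD addrACA subrr add0r -sumrB.
  apply: eq_bigr => s _; rewrite !S_f ?inE; [|lia|lia].
  ring.
under eq_bigr => j _ do rewrite gapE mulr_sumr.
rewrite exchange_big /=; apply: eq_bigr => s _.
rewrite -!letter_sign_sum -sumrB; apply: eq_bigr => j _.
by rewrite mulrBr.
Qed.

Lemma max_discrepancy_ge (eps : nat -> bool) :
  (2 * falls (2 * t * q) (fun x => letter_sign eps (f x)) <= max_discrepancy S)%N.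
Proof.
have [I hI IE] := swap_gain_attained (2 * t * q) (fun x => letter_sign eps (f x)).
apply: leq_trans (leq_bigmax_cond _ hI).
rewrite -lez_nat -IE -signed_gap_sum //.
rewrite /discrepancy (big_morph Posz PoszD (erefl _)).
apply: ler_sum => j _; rewrite abszE; apply: le_trans (ler_norm _) _.
by rewrite normrMsign.
Qed.

Lemma max_discrepancy_le (M : nat) :
  (forall eps, falls (2 * t * q) (fun x => letter_sign eps (f x)) <= M)%N ->
  (max_discrepancy S <= 2 * M)%N.
Proof.
move=> hM; apply/bigmax_leqP => I hI.
(* With these signs the signed sum of the gaps is the discrepancy itself. *)
pose eps j := gap I j < 0.
apply: (@leq_trans (2 * falls (2 * t * q) (fun x => letter_sign eps (f x)))%N).
  rewrite -lez_nat; apply: le_trans (swap_gain_le _ hI).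
  rewrite -signed_gap_sum // /discrepancy (big_morph Posz PoszD (erefl _)).
  by apply: ler_sum => j _; rewrite abszE normrEsign.
by rewrite leq_mul2l hM.
Qed.
End Coloured.

(** * Averaging over all choices of signs *)

Definition ffun_sign t (e : {ffun 'I_t -> bool}) (j : nat) : bool :=
  oapp e false (insub j).

Definition flip t (i : 'I_t) (e : {ffun 'I_t -> bool}) : {ffun 'I_t -> bool} :=
  [ffun j => e j (+) (j == i)].

Lemma flipK t (i : 'I_t) : involutive (flip i).
Proof. by move=> e; apply/ffunP => j; rewrite !ffunE -addbA addbb addbF. Qed.

Lemma letter_sign_flip t (i : 'I_t) e l :
  letter_sign (ffun_sign (flip i e)) l = letter_sign (ffun_sign e) l (+) (l./2 == i).
Proof.
rewrite /letter_sign /ffun_sign addbAC; congr (_ (+) _).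
case: insubP => [j _ jl|] /=; first by rewrite ffunE -jl -val_eqE.
by rewrite -leqNgt; case: eqP => // ->; rewrite leqNgt ltn_ord.
Qed.

(** [flip i] permutes the sign choices, so the sum equals its own negative. *)
Lemma sum_flip_eq0 t (i : 'I_t) (F : {ffun 'I_t -> bool} -> int) :
  (forall e, F (flip i e) = - F e) -> \sum_e F e = 0.
Proof.
move=> hF; have : \sum_e F e = - \sum_e F e.
  rewrite {1}(reindex_inj (inv_inj (flipK i))) /= -sumrN.
  by apply: eq_bigr => e _; rewrite hF.
lia.
Qed.

(** This is the probability bound 1/4, cleared of denominators. *)
Lemma sum_fall_ge t l l' : (l < 2 * t)%N -> (l' < 2 * t)%N -> l != l' ->
  (2 ^ t <= \sum_(e : {ffun 'I_t -> bool})
     4 * (~~ letter_sign (ffun_sign e) l && letter_sign (ffun_sign e) l'))%N.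
Proof.
move=> lt lt' ll'; set s := fun l (e : {ffun 'I_t -> bool}) => letter_sign (ffun_sign e) l.
rewrite -lez_nat (big_morph Posz PoszD (erefl _)).
(* If a and b are the signs of the two letters, 4 times the indicator of a = 1, b = -1 is (1 + a)(1
   - b) = 1 + a - b - ab. *)
have -> : \sum_(e : {ffun 'I_t -> bool}) Posz (4 * (~~ s l e && s l' e)) =
    \sum_(e : {ffun 'I_t -> bool}) 1 + \sum_e (-1) ^+ s l e - \sum_e (-1) ^+ s l' e
    - \sum_e (-1) ^+ (s l e (+) s l' e).
  rewrite -big_split -!sumrB /=; apply: eq_bigr => e _.
  by case: (s l e); case: (s l' e).
have hj : (l./2 < t)%N by lia.
have hj' : (l'./2 < t)%N by lia.
have s0 m (hm : (m./2 < t)%N) : \sum_e (-1) ^+ s m e = 0 :> int.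
  apply: (@sum_flip_eq0 _ (Ordinal hm)) => e.
  by rewrite /s letter_sign_flip /= eqxx addbT signrN.
rewrite !s0 // addr0 subr0 sumr_const card_ffun card_bool card_ord natz.
(* Letters of one pair have opposite signs, so ab is always -1; for letters of different pairs,
   flipping the pair of [l] negates ab. *)
case: (eqVneq l./2 l'./2) => [hll|hll].
  have odds : odd l != odd l'.
    apply: contra ll' => /eqP ho.
    by rewrite -(odd_double_half l) -(odd_double_half l') hll ho.
  rewrite (eq_bigr (fun => -1 : int)) => [|e _].
    by rewrite sumr_const card_ffun card_bool card_ord; lia.
  rewrite /s /letter_sign hll; move: odds.
  by case: (odd l); case: (odd l'); case: (ffun_sign e _).
rewrite (@sum_flip_eq0 _ (Ordinal hj)) ?subr0 // => e.
rewrite /s !letter_sign_flip /= eqxx eq_sym (negbTE hll) addbF addbAC addbT.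
by rewrite signrN.
Qed.

(** Double counting of falls over all positions and all 2^t sign choices: each boundary is a fall
    for at least a quarter of the choices, and each choice has at most [M] falls. *)
Lemma boundaries_le t n M (f : nat -> nat) :
  (forall x, (x < n)%N -> (f x < 2 * t)%N) ->
  (forall eps, falls n (fun x => letter_sign eps (f x)) <= M)%N ->
  (\sum_(x < n.-1) (f x != f x.+1) <= 4 * M)%N.
Proof.
move=> f_lt hM; rewrite -(@leq_pmul2l (2 ^ t)) ?expn_gt0 // big_distrr /=.
apply: (@leq_trans (\sum_(x < n.-1) \sum_(e : {ffun 'I_t -> bool})
   4 * (~~ letter_sign (ffun_sign e) (f x) && letter_sign (ffun_sign e) (f x.+1)))%N).
  apply: leq_sum => x _; case: eqVneq => //= fx; rewrite ?muln0 ?muln1 //.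
  by have := ltn_ord x => xn; apply: sum_fall_ge => //; apply: f_lt; lia.
rewrite exchange_big /=.
apply: (@leq_trans (\sum_(e : {ffun 'I_t -> bool}) 4 * M)%N).
  by apply: leq_sum => e _; rewrite -big_distrr leq_mul2l hM.
by rewrite sum_nat_const card_ffun card_bool card_ord.
Qed.

(** * Runs of letters *)

Definition run_start (f : nat -> nat) (x : nat) : bool := (x == 0)%N || (f x.-1 != f x).

(** Take the least position after [b] carrying [a]: its predecessor is [b] or a later position
    skipped by minimality, so it does not carry [a]. *)
Lemma first_run_start (f : nat -> nat) a n b : (b < n)%N -> f n = a -> f b != a ->
  exists y, [/\ (b < y <= n)%N, f y = a & run_start f y].
Proof.
move=> bn fn fb.
have ex : exists y, (b < y)%N && (f y == a) by exists n; rewrite bn fn eqxx.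
case: (ex_minnP ex) => y /andP[byz /eqP fy] ymin; exists y; split=> //.
  by rewrite byz ymin // bn fn eqxx.
rewrite /run_start fy; apply/orP; right; apply: contra fb => fy1.
have [//|yb] := eqVneq b y.-1; first by move=> ->.
have := ymin y.-1; rewrite fy1 andbT; lia.
Qed.

Lemma first_occurrence (f : nat -> nat) n a (q : nat) :
  (0 < q)%N -> #|[set x : 'I_n | f x == a]| = q ->
  exists y, [/\ (y < n)%N, f y = a, run_start f y &
    forall x, f x = a -> (y <= x)%N].
Proof.
move=> q0 hq; have : (0 < #|[set x : 'I_n | f x == a]|)%N by rewrite hq.
case/card_gt0P => x; rewrite inE => fx.
have ex : exists y, f y == a by exists x.
case: (ex_minnP ex) => y /eqP fy ymin; exists y; split=> //.
- by apply: leq_ltn_trans (ltn_ord x); apply: ymin.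
- rewrite /run_start fy; case: y fy ymin => //= y fy ymin.
  by apply/negP => /ymin; rewrite ltnn.
by move=> z /eqP; apply: ymin.
Qed.

(** The first [a], the first [b], and a return of the earlier letter after the other has appeared
    are three run starts; equality of the sums forces the return. *)
Lemma three_run_starts (f : nat -> nat) n a b (q : nat) :
  (0 < q)%N -> a != b ->
  #|[set x : 'I_n | f x == a]| = q -> #|[set x : 'I_n | f x == b]| = q ->
  Sigma [set x : 'I_n | f x == a] = Sigma [set x : 'I_n | f x == b] ->
  exists s : {set 'I_n}, (2 < #|s|)%N /\
    (forall x : 'I_n, x \in s -> ((f x == a) || (f x == b)) && run_start f x).
Proof.
move=> q0 ab ca cb sab.
have [a0 [a0n fa0 ra0 mina]] := first_occurrence q0 ca.
have [b0 [b0n fb0 rb0 minb]] := first_occurrence q0 cb.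
(* The letter that occurs first is called [a]. *)
wlog ab0 : a b ab ca cb sab a0 a0n fa0 ra0 mina b0 b0n fb0 rb0 minb / (a0 < b0)%N.
  move=> hw; case: (ltngtP a0 b0) => h; first exact: (hw a b ab ca cb sab a0 _ _ _ _ b0).
    have [] := hw b a _ cb ca (esym sab) b0 b0n fb0 rb0 minb a0 a0n fa0 ra0 mina h.
      by rewrite eq_sym.
    by move=> s [cs hs]; exists s; split=> // x /hs; rewrite orbC.
  by move: ab; rewrite -fa0 -fb0 h eqxx.
have [z [zn fz b0z]] : exists z, [/\ (z < n)%N, f z = a & (b0 < z)%N].
  case: (pickP [pred z : 'I_n | (f z == a) && (b0 < z)%N]) => [z /andP[/eqP fz bz]|no].
    by exists z.
  (* Without a later [a], all labels of [a] are at most [b0.+1], the one at [a0] strictly less,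
     while all labels of [b] are at least [b0.+1]. *)
  have : (Sigma [set x : 'I_n | f x == a] < q * b0.+1)%N.
    rewrite -ca -sum_nat_const /Sigma (bigD1 (Ordinal a0n)) ?inE ?fa0 //=.
    rewrite [X in (_ < X)%N](bigD1 (Ordinal a0n)) ?inE ?fa0 //= -addSn.
    apply: leq_add => //; apply: leq_sum => x; rewrite inE => /andP[fx _].
    by have := no x; rewrite /= fx /=; lia.
  suff : (q * b0.+1 <= Sigma [set x : 'I_n | f x == b])%N by rewrite sab; lia.
  rewrite -cb -sum_nat_const; apply: leq_sum => x; rewrite inE => /eqP fx.
  by rewrite ltnS; apply: minb.
have fba : f b0 != a by rewrite fb0 eq_sym.
have [y [/andP[b0y yz] fy ry]] := first_run_start b0z fz fba.
have yn : (y < n)%N by apply: leq_ltn_trans zn.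
exists [set Ordinal a0n; Ordinal b0n; Ordinal yn]; split.
  rewrite -setUA !cardsU1 cards1 !inE -!val_eqE /=; lia.
move=> x; rewrite !inE -!orbA => /or3P[] /eqP -> /=.
- by rewrite fa0 eqxx ra0.
- by rewrite fb0 eqxx orbT rb0.
by rewrite fy eqxx ry.
Qed.

(** There is one more run start than boundaries, namely position 0. Grouping the run starts by the
    pair of their letter gives [t] groups of at least three. *)
Lemma boundaries_ge t n q (f : nat -> nat) :
  (0 < t)%N -> (0 < q)%N ->
  (forall x, (x < n)%N -> (f x < 2 * t)%N) ->
  (forall i, (i < 2 * t)%N -> #|[set x : 'I_n | f x == i]| = q) ->
  (forall j, (j < t)%N -> Sigma [set x : 'I_n | f x == 2 * j]%N =
                          Sigma [set x : 'I_n | f x == 2 * j + 1]%N) ->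
  (3 * t <= 1 + \sum_(x < n.-1) (f x != f x.+1))%N.
Proof.
move=> t0 q0 f_lt cf sf.
case: n => [|m] in f_lt cf sf *.
  (* The empty word is excluded, since letter 0 occurs [q] > 0 times. *)
  by have := cf 0%N; rewrite eq_card0 => [|[]//]; lia.
have -> : (1 + \sum_(x < m) (f x != f x.+1) = \sum_(x < m.+1) run_start f x)%N.
  by rewrite big_ord_recl; congr addn; apply: eq_bigr => x _; rewrite /run_start /bump.
have hp (x : 'I_m.+1) : ((f x)./2 < t)%N by have := f_lt x (ltn_ord x); lia.
rewrite (partition_big (fun x : 'I_m.+1 => Ordinal (hp x)) predT) //=.
rewrite mulnC -[t in (t * _)%N]card_ord -sum_nat_const; apply: leq_sum => j _.
have jt := ltn_ord j.
have [||||s [cs hs]] := @three_run_starts f m.+1 (2 * j)%N (2 * j + 1)%N q q0.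
- by apply/eqP; lia.
- by apply: cf; lia.
- by apply: cf; lia.
- exact: sf.
apply: leq_trans cs _; rewrite -sum1_card big_mkcond [X in (_ <= X)%N]big_mkcond /=.
apply: leq_sum => x _; case: ifP => // /hs /andP[fx ->].
have -> : Ordinal (hp x) == j by rewrite -val_eqE /=; case/orP: fx => /eqP ->; lia.
by [].
Qed.

(** * The lower bound *)

Lemma balanced_colouring q t (S : (2 * t).-tuple {set 'I_(2 * t * q)}) :
  balanced_family S -> exists f : nat -> nat,
  (forall x, (x < 2 * t * q)%N -> (f x < 2 * t)%N) /\
  (forall i, (i < 2 * t)%N ->
     nth set0 S i = [set x : 'I_(2 * t * q) | f x == i]).
Proof.
case=> _ dS cS _.
have [|F hF] := @fin_all_exists _ _ (fun (x : 'I_(2 * t * q)) i => x \in tnth S i).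
  move=> x; have : x \in \bigcup_(i < 2 * t) tnth S i by rewrite cS inE.
  by case/bigcupP => i _ xi; exists i.
(* The colouring is extended to [nat], by the letter 0 beyond the last position, so that [f x.+1]
   can be written without a bound. *)
exists (fun x => oapp (fun y => val (F y)) 0%N (insub x)); split.
  by move=> x xn; rewrite insubT /=.
move=> i it; apply/setP => x; rewrite inE valK /=.
have -> : nth set0 S i = tnth S (Ordinal it) by rewrite (tnth_nth set0).
apply/idP/eqP => [xi|Fx]; last first.
  by have := hF x; congr (x \in tnth S _); apply: val_inj.
have := hF x; have [->//|ne] := eqVneq (F x) (Ordinal it).
by have /pred0P/(_ x) /= := dS _ _ ne; rewrite xi andbT => -> .
Qed.

Lemma max_discrepancy_lower q t (S : (2 * t).-tuple {set 'I_(2 * t * q)}) :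
  (0 < t)%N -> (0 < q)%N -> balanced_family S ->
  (3 * t <= 1 + 2 * max_discrepancy S)%N.
Proof.
move=> t0 q0 bS; have [f [f_lt Sf]] := balanced_colouring bS.
case: bS => cS _ _ sS.
apply: leq_trans (@boundaries_ge t (2 * t * q) q f t0 q0 f_lt _ _) _.
- by move=> i it; have := cS (Ordinal it); rewrite (tnth_nth set0) /= Sf.
- by move=> j jt; rewrite -!Sf; [apply: (sS (Ordinal jt))|lia|lia].
(* Twice the number of falls is at most the discrepancy, so half of the latter, rounded down, bounds
   the falls. *)
rewrite leq_add2l; apply: leq_trans (boundaries_le (M := (max_discrepancy S)./2) f_lt _) _.
  move=> eps; rewrite geq_half_double -mul2n.
  by apply: max_discrepancy_ge => // x; apply: f_lt.
by have := odd_double_half (max_discrepancy S); rewrite -mul2n; lia.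
Qed.

Local Close Scope ring_scope.

(** * Falls and position sums of words *)

Fixpoint seq_falls (x : bool) (s : seq bool) : nat :=
  if s is y :: s' then (~~ x && y) + seq_falls y s' else 0.

Lemma seq_falls_cat x s1 s2 :
  seq_falls x (s1 ++ s2) = seq_falls x s1 + seq_falls (last x s1) s2.
Proof. by elim: s1 x => [|y s1 IH] x //=; rewrite IH addnA. Qed.

Lemma falls_seq (T : Type) (x0 : T) (g : T -> bool) a s :
  falls (size s).+1 (fun i => g (nth x0 (a :: s) i)) = seq_falls (g a) (map g s).
Proof.
rewrite /falls /=; elim: s a => [|b s IH] a /=; first by rewrite big_ord0.
by rewrite big_ord_recl -IH.
Qed.

(* Positions are counted from 1, in accordance with [Sigma]. *)
Fixpoint position_sum (i : nat) (w : seq nat) : nat :=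
  if w is a :: w' then (a == i) + position_sum i w' + count_mem i w' else 0.

Lemma position_sum_cat i u v :
  position_sum i (u ++ v) = position_sum i u + position_sum i v + size u * count_mem i v.
Proof.
elim: u => [|a u IH] /=; first by rewrite mul0n addn0.
by rewrite IH count_cat mulSn; ring.
Qed.

Lemma position_sumE i w :
  \sum_(x < size w | nth 0 w x == i) x.+1 = position_sum i w.
Proof.
rewrite big_mkcond; elim: w => [|a w IH] /=; first by rewrite big_ord0.
rewrite big_ord_recl /= -IH.
have -> : count_mem i w = \sum_(x < size w) (nth 0 w x == i).
  rewrite -sum1_count (big_nth 0) big_mkord big_mkcond /=.
  by apply: eq_bigr => x _; case: ifP.
rewrite -addnA -big_split /=; congr (_ + _).
by apply: eq_bigr => x _; rewrite /bump !add0n add1n; case: ifP; rewrite ?addn1.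
Qed.

Lemma card_letter i w : #|[set x : 'I_(size w) | nth 0 w x == i]| = count_mem i w.
Proof.
by rewrite -sum1_count (big_nth 0) big_mkord sum1dep_card.
Qed.

(** * Repeating every letter *)

Definition blow_up (k : nat) (w : seq nat) : seq nat := flatten [seq nseq k a | a <- w].

Lemma size_blow_up k w : size (blow_up k w) = k * size w.
Proof. by elim: w => [|a w IH] /=; rewrite ?muln0 // size_cat size_nseq IH mulnS. Qed.

Lemma count_blow_up k i w : count_mem i (blow_up k w) = k * count_mem i w.
Proof.
elim: w => [|a w IH] /=; first by rewrite muln0.
by rewrite count_cat IH count_nseq /= mulnDr mulnC.
Qed.

Lemma position_sum_nseq i k a : position_sum i (nseq k a) = (a == i) * 'C(k.+1, 2).
Proof.
elim: k => [|k IH] /=; first by rewrite muln0.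
by rewrite IH count_nseq /= [in RHS]binS bin1; lia.
Qed.

(** A letter at position p fills the positions k(p-1)+1, ..., kp, whose sum is k*k*(p-1) + 'C(k+1,
    2). Hence letters with equal counts and position sums keep this property. *)
Lemma position_sum_blow_up k i w :
  position_sum i (blow_up k w) =
  'C(k.+1, 2) * count_mem i w + k * k * (position_sum i w - count_mem i w).
Proof.
(* This keeps the truncated subtraction exact. *)
have le v : count_mem i v <= position_sum i v by elim: v => //= a v IH; lia.
elim: w => [|a w IH] /=; first by rewrite !muln0.
rewrite position_sum_cat position_sum_nseq size_nseq -/(blow_up k w) IH count_blow_up.
have := le w; set c := count_mem i w; set p := position_sum i w => cp.
have -> : (a == i) + p + c - ((a == i) + c) = p - c + c by lia.
by ring.
Qed.

Lemma last_nseq (T : Type) (x : T) k : last x (nseq k x) = x.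
Proof. by elim: k. Qed.

Lemma seq_falls_nseq x k : seq_falls x (nseq k x) = 0.
Proof. by elim: k => //= k ->; case: x. Qed.

(** No fall lies inside a block of equal letters, and the block borders reproduce the adjacent
    letters of the original word. *)
Lemma seq_falls_blow_up (g : nat -> bool) k a w :
  0 < k ->
  seq_falls (g a) (map g (blow_up k w)) = seq_falls (g a) (map g w).
Proof.
case: k => // k _; elim: w a => [|b w IH] a //=.
rewrite map_cat map_nseq seq_falls_cat seq_falls_nseq add0n.
by rewrite last_nseq IH.
Qed.

(** * Balanced words and the families they define *)

Definition balanced_word (q t : nat) (w : seq nat) : Prop :=
  [/\ size w = 2 * t * q,
      all (fun l => l < 2 * t) w,
      forall i, i < 2 * t -> count_mem i w = q
    & forall j, j < t -> position_sum (2 * j) w = position_sum (2 * j + 1) w].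

(** [eps] ranges over all of [nat -> bool], so that a shifted [eps] is again admissible; this serves
    the copy of [w] on fresh letters. *)
Definition few_falls (M : nat) (w : seq nat) : Prop :=
  forall eps, seq_falls (letter_sign eps (head 0 w))
                (map (letter_sign eps) (behead w)) <= M.

Lemma balanced_blow_up k q t w :
  balanced_word q t w -> balanced_word (k * q) t (blow_up k w).
Proof.
case=> sw lw cw pw; split.
- by rewrite size_blow_up sw; lia.
- apply/allP => l /flattenP[_ /mapP[a aw ->]] /nseqP[-> _].
  by move/allP: lw; apply.
- by move=> i it; rewrite count_blow_up cw.
by move=> j jt; rewrite !position_sum_blow_up pw // !cw //; lia.
Qed.

Lemma few_falls_blow_up k M w : 0 < k -> few_falls M w -> few_falls M (blow_up k w).
Proof.
move=> k0 hw eps; case: w hw => [|a w] hw //; apply: leq_trans (hw eps).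
case: k k0 => // k _ /=.
rewrite map_cat map_nseq seq_falls_cat seq_falls_nseq add0n.
by rewrite last_nseq -/(blow_up k.+1 w) seq_falls_blow_up.
Qed.

Lemma few_falls_discrepancy q t M w :
  balanced_word q t w -> few_falls M w ->
  exists S : (2 * t).-tuple {set 'I_(2 * t * q)},
    balanced_family S /\ max_discrepancy S <= 2 * M.
Proof.
case=> sw lw cw pw fw.
pose S := [tuple [set x : 'I_(2 * t * q) | nth 0 w x == i] | i < 2 * t].
have SE i : i < 2 * t -> nth set0 S i = [set x : 'I_(2 * t * q) | nth 0 w x == i].
  by move=> it; rewrite -[i]/(val (Ordinal it)) -tnth_nth tnth_mktuple.
have wlt (x : 'I_(2 * t * q)) : nth 0 w x < 2 * t.
  by move/allP: lw; apply; rewrite mem_nth // sw.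
have sS (j : 'I_t) : Sigma (nth set0 S (2 * j)) = Sigma (nth set0 S (2 * j + 1)).
  have jt := ltn_ord j; rewrite !SE; [|lia|lia].
  have E i : Sigma [set x : 'I_(2 * t * q) | nth 0 w x == i] = position_sum i w.
    by rewrite /Sigma -sw -position_sumE; apply: eq_bigl => x; rewrite inE.
  by rewrite !E pw.
exists S; split; first split=> //.
- by move=> i; have := card_letter i w; rewrite sw cw // tnth_mktuple.
- move=> i j ij; rewrite !tnth_mktuple; apply/pred0P => x /=; rewrite !inE.
  apply/negP => /andP[/eqP-> /eqP h]; case/eqP: ij; exact: val_inj.
- apply/setP => x; rewrite inE; apply/bigcupP; exists (Ordinal (wlt x)) => //.
  by rewrite tnth_mktuple inE.
apply: (max_discrepancy_le wlt SE sS) => eps.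
case: w {lw cw pw SE wlt sS S} sw fw => [|a w] sw fw.
  by rewrite -sw /falls big_ord0.
by rewrite -sw falls_seq; apply: fw.
Qed.

(** * The recursive construction for q = 2 *)

(* Found by exhaustive search among the words with q = 2 and t = 4. *)
Definition base_word : seq nat :=
  [:: 0; 2; 4; 3; 3; 5; 2; 1; 1; 6; 5; 7; 7; 4; 6; 0].

(** The new pair is X = 4t, Y = 4t + 1. When [w] has length 4t, X sits at positions 1 and 8t + 4 and
    Y at 4t + 2 and 4t + 3, both with sum 8t + 5. *)
Definition join_words (t : nat) (w : seq nat) : seq nat :=
  4 * t :: w ++ [:: 4 * t + 1; 4 * t + 1] ++ map (addn (2 * t)) w ++ [:: 4 * t].

Fixpoint tree_word (m : nat) : seq nat :=
  if m is m'.+1 then join_words (5 * 2 ^ m' - 1) (tree_word m') else base_word.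

Definition closed_word (w : seq nat) := w != [::] /\ head 0 w = last 0 w.

Lemma base_word_spec :
  [/\ balanced_word 2 4 base_word, few_falls 3 base_word & closed_word base_word].
Proof.
split=> //; last first.
  move=> eps; rewrite /letter_sign /=.
  by case: (eps 0); case: (eps 1); case: (eps 2); case: (eps 3).
split=> //.
- by do 8 case=> //.
by do 4 case=> //.
Qed.

Lemma join_words_spec t M w : 0 < t ->
  balanced_word 2 t w -> few_falls M w -> closed_word w ->
  [/\ balanced_word 2 (2 * t).+1 (join_words t w),
      few_falls (2 * M).+1 (join_words t w) & closed_word (join_words t w)].
Proof.
move=> t0 [sw lw cw pw] fw [w0 clw]; split; last 1 first.
- by split=> //; rewrite /= last_cat /= last_cat.
- have cw0 i : 2 * t <= i -> count_mem i w = 0.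
    move=> ti; apply/count_memPn/negP => iw.
    by move/allP/(_ _ iw): lw; rewrite ltnNge ti.
  have pw0 i : 2 * t <= i -> position_sum i w = 0.
    by move/cw0; elim: (w) => //= a v IH h; rewrite IH; lia.
  have cm i : count_mem i (map (addn (2 * t)) w) =
      if 2 * t <= i then count_mem (i - 2 * t) w else 0.
    rewrite count_map; case: leqP => ti.
      by apply: eq_count => x /=; lia.
    by apply/eqP; rewrite -leqn0 leqNgt -has_count; apply/hasPn => x _ /=; lia.
  have pm i : position_sum i (map (addn (2 * t)) w) =
      if 2 * t <= i then position_sum (i - 2 * t) w else 0.
    elim: (w) => [|a v IH] /=; first by case: ifP.
    rewrite IH count_map; case: leqP => ti.
      congr (_ + _ + _); first lia.
      by apply: eq_count => x /=; lia.
    have -> : count (preim (addn (2 * t)) (pred1 i)) v = 0.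
      by apply/eqP; rewrite -leqn0 leqNgt -has_count; apply/hasPn => x _ /=; lia.
    lia.
  split.
  - by rewrite /= !size_cat /= size_cat size_map /= sw; lia.
  - rewrite /= !all_cat /= all_cat /= all_map.
    have -> : all (fun l => l < 2 * (2 * t).+1) w.
      by apply: sub_all lw => x; lia.
    have -> : all (preim (addn (2 * t)) (fun l => l < 2 * (2 * t).+1)) w.
      by apply: sub_all lw => x /=; lia.
    lia.
  - move=> i it; rewrite /= !count_cat /= count_cat /= cm.
    case: (leqP (2 * t) i) => ti.
      rewrite (cw0 i) //; case: (ltnP i (4 * t)) => ti4; first by rewrite (cw (i - 2 * t)); lia.
      by rewrite (cw0 (i - 2 * t)); lia.
    by rewrite (cw i) //; lia.
  move=> j jt.
  rewrite /= !position_sum_cat /= !position_sum_cat !count_cat /= !count_cat /=.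
  rewrite size_map sw !cm !pm.
  (* Three kinds of pairs: those of [w], those of its copy, and the new one. The copy shifts both
     letters of a pair equally, as they have equal counts. *)
  case: (ltnP j t) => j1.
    have -> : (2 * t <= 2 * j) = false by lia.
    have -> : (2 * t <= 2 * j + 1) = false by lia.
    by rewrite pw // (cw (2 * j)) ?(cw (2 * j + 1)); lia.
  have -> : (2 * t <= 2 * j) = true by lia.
  have -> : (2 * t <= 2 * j + 1) = true by lia.
  rewrite (cw0 (2 * j)) ?(cw0 (2 * j + 1)) ?(pw0 (2 * j)) ?(pw0 (2 * j + 1)); try lia.
  have -> : 2 * j - 2 * t = 2 * (j - t) by lia.
  have -> : 2 * j + 1 - 2 * t = 2 * (j - t) + 1 by lia.
  case: (ltnP j (2 * t)) => j2.
    by rewrite pw ?(cw (2 * (j - t))) ?(cw (2 * (j - t) + 1)); lia.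
  have -> : j = 2 * t by lia.
  rewrite !(cw0 (2 * (_ - t))) ?(cw0 (2 * (_ - t) + 1)); try lia.
  by rewrite (pw0 (2 * (_ - t))) ?(pw0 (2 * (_ - t) + 1)); lia.
move=> eps; rewrite /= !map_cat /= map_cat /= -map_comp.
case: w w0 clw fw {sw lw cw pw} => // a w _ /= clw fw.
have shift l : letter_sign eps (2 * t + l) = letter_sign (fun j => eps (t + j)) l.
  by rewrite /letter_sign halfD mul2n odd_double /= doubleK add0n oddD odd_double.
have A1 : letter_sign eps (4 * t) = eps (2 * t).
  by rewrite /letter_sign (_ : 4 * t = (2 * t).*2) ?doubleK ?odd_double ?addbF //; lia.
have B1 : letter_sign eps (4 * t + 1) = ~~ eps (2 * t).
  rewrite /letter_sign (_ : 4 * t + 1 = (2 * t).*2.+1); last lia.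
  by rewrite /= uphalf_double odd_double /= addbT.
have mapE : map (letter_sign eps \o addn (2 * t)) w =
            map (letter_sign (fun j => eps (t + j))) w.
  by apply: eq_map => l /=; rewrite shift.
(* If X is + and Y is -, exactly one of the steps X to [w] and [w] to Y is a fall, because both ends
   of [w] have the same sign, and the borders of the copy give none. If X is - and Y is +, the roles
   of [w] and its copy are exchanged. *)
rewrite !seq_falls_cat /= !seq_falls_cat /= !mapE !shift A1 B1 !last_map -clw.
have := fw eps; have := fw (fun j => eps (t + j)); rewrite /=.
by case: (eps (2 * t)); case: (letter_sign eps a);
  case: (letter_sign (fun j => eps (t + j)) a) => /=; lia.
Qed.

(** Each joining step sends t to 2t + 1 and M to 2M + 1, so t + 1 and M + 1 double, starting from 5
    and 4. *)
Lemma tree_word_spec m :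
  [/\ balanced_word 2 (5 * 2 ^ m - 1) (tree_word m),
      few_falls (4 * 2 ^ m - 1) (tree_word m) & closed_word (tree_word m)].
Proof.
elim: m => [|m [bw fw cw]]; first exact: base_word_spec.
have p0 : 0 < 2 ^ m by rewrite expn_gt0.
have [|bj fj cj] := join_words_spec _ bw fw cw; first lia.
rewrite expnS; split=> //=.
  by have -> : 5 * (2 * 2 ^ m) - 1 = (2 * (5 * 2 ^ m - 1)).+1 by lia.
by have -> : 4 * (2 * 2 ^ m) - 1 = (2 * (4 * 2 ^ m - 1)).+1 by lia.
Qed.

Local Open Scope ring_scope.

Theorem mainTheorem4 (q : nat) (hq : (2 < q)%N) :
  (forall (t : nat) (S : (2 * t).-tuple {set 'I_(2 * t * q)}),
     (0 < t)%N -> balanced_family S ->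
     (3 * t%:R - 2) / 2 <= (max_discrepancy S)%:R :> rat)
  /\
  (forall k : nat, q = (2 * k)%N ->
   forall z t : nat, (2 <= z)%N -> t = (5 * 2 ^ (z - 1) - 1)%N ->
   exists S : (2 * t).-tuple {set 'I_(2 * t * q)},
     balanced_family S /\
     (max_discrepancy S)%:R <= (8 * t%:R - 2) / 5 :> rat).
Proof.
split=> [t S t0 bS|k qE z t z2 tE].
  (* This gives the bound (3t - 1)/2, which exceeds the required one by 1/2. *)
  have := max_discrepancy_lower t0 (ltnW (ltnW hq)) bS.
  rewrite -(ler_nat rat) natrD !natrM => h; lra.
have [bw fw _] := tree_word_spec (z - 1).
have k0 : (0 < k)%N by lia.
have := few_falls_discrepancy (balanced_blow_up k bw) (few_falls_blow_up k0 fw).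
rewrite -tE (mulnC k) -qE => -[S [bS hS]]; exists S; split=> //.
have p0 : (0 < 2 ^ (z - 1))%N by rewrite expn_gt0.
(* With p = 2^(z-1), t = 5p - 1 and M = 4p - 1, one has 5 * 2M + 2 = 40p - 8 = 8t. *)
have h : (5 * max_discrepancy S + 2 <= 8 * t)%N by lia.
by move: h; rewrite -(ler_nat rat) natrD !natrM => h; lra.
Qed.
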